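(* Let $x_0>0$ and $n\in\mathbb{N}_0$. The function $\mathcal{L}$ on the interval $I=[0,x_0]$ is approximated by the polynomial function $$p_n(x)=\frac{a_0}{2}+\sum_{k=1}^n a_kT_k(x),$$ where the coefficients $\{a_k\}_{k=0}^n$ are given by $$a_0=x_0\left(\log\left(\frac{x_0}{4}\right)+1\right),\qquad a_1=\frac{x_0}{4}\left(2\log\left(\frac{x_0}{4}\right)+3\right),\qquad a_k=\frac{(-1)^kx_0}{k(k^2-1)}\quad (k\ge 2),$$ in the sense that, for $n\ge 1$, there holds the error estimate $$\|\mathcal{L}-p_n\|_{\infty,(0,x_0)}\le\frac{x_0}{2n(n+1)}.$$
   Context: The function $\mathcal{L}:[0,\infty)\to\mathbb{R}$ is defined by $\mathcal{L}(x)=x\log(x)$ for $x>0$ and $\mathcal{L}(0)=0$ ($\log$ is the natural logarithm). The Chebyshev polynomials of the first kind on $[-1,1]$ are $\widehat T_k(\widehat x)=\cos(k\arccos(\widehat x))$, $k\ge 0$; equivalently $\widehat T_0(\widehat x)=1$, $\widehat T_1(\widehat x)=\widehat x$, $\widehat T_{k+1}(\widehat x)=2\widehat x\,\widehat T_k(\widehat x)-\widehat T_{k-1}(\widehat x)$ for $k\ge1$. For $x_0>0$, the transformed Chebyshev polynomials on $I=[0,x_0]$ are $T_k(x)=\widehat T_k\left(\frac{2}{x_0}x-1\right)$. The symbol $\|\cdot\|_{\infty,(0,x_0)}$ denotes the supremum norm on $I=[0,x_0]$. *)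

(* Defs.v *)
From HB Require Import structures.
From mathcomp Require Import all_boot all_order all_algebra.
From mathcomp Require Import ring.
From mathcomp Require Import all_classical all_reals all_analysis.
Set Implicit Arguments.
Unset Strict Implicit.
Unset Printing Implicit Defensive.
Import Order.TTheory GRing.Theory Num.Theory.
Local Open Scope classical_set_scope.
Local Open Scope ring_scope.

(* Only the values on [0, +oo[ are meaningful. *)
Definition xlogx (R : realType) (x : R) : R :=
  if 0 < x then x * ln x else 0.

(* [chebyshevT_pair R k] is the pair of the Chebyshev polynomials of the first
   kind of degrees k and k + 1. *)
Fixpoint chebyshevT_pair (R : realType) (k : nat) : {poly R} * {poly R} :=
  if k is j.+1 then
    let: (p, q) := chebyshevT_pair R j in (q, 2%:P * 'X * q - p)
  else (1, 'X).

Definition chebyshevT (R : realType) (k : nat) : {poly R} :=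
  (chebyshevT_pair R k).1.

Lemma chebyshevT0 (R : realType) : chebyshevT R 0 = 1.
Proof. by []. Qed.

Lemma chebyshevT1 (R : realType) : chebyshevT R 1 = 'X.
Proof. by []. Qed.

Lemma chebyshevTSS (R : realType) (k : nat) :
  chebyshevT R k.+2 = 2%:P * 'X * chebyshevT R k.+1 - chebyshevT R k.
Proof. by rewrite /chebyshevT /=; case: (chebyshevT_pair R k). Qed.

Lemma chebyshevT_cos (R : realType) (k : nat) (x : R) :
  -1 <= x <= 1 -> (chebyshevT R k).[x] = cos (k%:R * acos x).
Proof.
move=> hx; have hc : cos (acos x) = x by apply: acosK; rewrite in_itv.
suff: (chebyshevT R k).[x] = cos (k%:R * acos x) /\
      (chebyshevT R k.+1).[x] = cos (k.+1%:R * acos x) by case.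
elim: k => [|k [IH0 IH1]].
  by rewrite chebyshevT0 chebyshevT1 hornerC hornerX mul0r cos0 mul1r hc.
split=> //; rewrite chebyshevTSS !hornerE IH0 IH1.
set t := acos x in hc *.
have -> : k.+2%:R * t = k.+1%:R * t + t by rewrite -[k.+2]addn1 natrD mulrDl mul1r.
have -> : k%:R * t = k.+1%:R * t - t.
  by rewrite -[k.+1]addn1 natrD mulrDl mul1r addrK.
by rewrite cosB cosD hc; ring.
Qed.

Definition chebyshevT_trans (R : realType) (x0 : R) (k : nat) : {poly R} :=
  chebyshevT R k \Po ((2 / x0) *: 'X - 1).

Definition xlogx_coef (R : realType) (x0 : R) (k : nat) : R :=
  match k with
  | 0 => x0 * (ln (x0 / 4) + 1)
  | 1 => x0 / 4 * (2 * ln (x0 / 4) + 3)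
  | _ => (-1) ^+ k * x0 / (k%:R * (k%:R ^+ 2 - 1))
  end.

Definition xlogx_approx (R : realType) (x0 : R) (n : nat) : {poly R} :=
  (xlogx_coef x0 0 / 2)%:P +
  \sum_(1 <= k < n.+1) xlogx_coef x0 k *: chebyshevT_trans x0 k.

(* The supremum is taken in the extended reals, so that it is +oo (and not a
   default real value) when f is unbounded on [a, b]. *)
Definition sup_norm (R : realType) (a b : R) (f : R -> R) : \bar R :=
  ereal_sup [set `|f x|%:E | x in `[a, b]].

(* Main.v *)
Require Import Defs.
From HB Require Import structures.
From mathcomp Require Import all_boot all_order all_algebra.
From mathcomp Require Import ring lra.
From mathcomp Require Import all_classical all_reals all_analysis.
Import Order.TTheory GRing.Theory Num.Theory.
Import numFieldNormedType.Exports.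
Local Open Scope classical_set_scope.
Local Open Scope ring_scope.

(** The bound is the tail of the coefficient series: since the polynomials
    T_k are bounded by 1 on [[0, x0]], and 1 / (k (k^2 - 1)) is a telescoping
    difference, the terms of index k > n add up to at most
    x0 / (2 n (n + 1)) ([xlogx_approx_tail]). It therefore suffices that
    p_m(x) tends to x log x for each fixed x, and an error O(1/m) is enough.

    To see this convergence, write x = x0 (1 + c) / 2 with c in [[-1, 1]], so
    that x log x = x log (x0 / 4) + x log (2 (1 + c)). The last logarithm is
    given by the series
      log (2 (1 + c)) / 2 = sum_(k >= 1) (-1)^(k-1) T_k(c) / k.
    It is the value at r = 1 of the expansion of log (1 + 2 c r + r^2) / 2 in
    powers of r, that is of log |1 + r e^(it)| where c = cos t. The
    r-derivative of the expansion is a rational function whose partial sums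
    have a closed form, because of the recurrence of the T_k; the mean value
    theorem turns the closed form of the remainder into the bound
    4 / ((1 + c) (m + 1)) ([ln_chebyshev_series]). The factor 1 + c in this
    denominator is what the factor x in x log x compensates.

    Multiplication of the logarithmic series by 1 + c is a second difference
    on the coefficients (-1)^(k-1) / k, because 2 c T_k = T_(k+1) + T_(k-1).
    It yields exactly the coefficients a_k, up to two boundary terms of size
    O(1/m) ([xlogx_approx_ln_series]). *)

(** * Bounds on Chebyshev polynomials *)

Lemma chebyshevT_norm_le1 {R : realType} (k : nat) (c : R) :
  -1 <= c <= 1 -> `|(chebyshevT R k).[c]| <= 1.
Proof. by move=> hc; rewrite chebyshevT_cos// cos_max. Qed.

Lemma chebyshevT_hornerSS {R : realType} (k : nat) (c : R) :
  (chebyshevT R k.+2).[c] =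
  2 * c * (chebyshevT R k.+1).[c] - (chebyshevT R k).[c].
Proof. by rewrite chebyshevTSS !hornerE. Qed.

(** * The logarithmic Chebyshev series *)

(** The partial sums of the expansion in powers of r of
    log (1 + 2 c r + r^2) / 2. *)
Definition ln_series {R : realType} (c : R) (m : nat) : {poly R} :=
  \sum_(k < m) ((-1) ^+ k * (chebyshevT R k.+1).[c] / k.+1%:R) *: 'X^(k.+1).

(** The generating function of the Chebyshev polynomials, with its remainder:
    after multiplication by 1 + 2 c r + r^2 the recurrence cancels everything
    but the first and last two terms. *)
Lemma ln_series_deriv {R : realType} (c r : R) (m : nat) :
  (1 + 2 * c * r + r ^+ 2) * (ln_series c m)^`().[r] =
  c + r - (-1) ^+ m * r ^+ m *
    ((chebyshevT R m.+1).[c] + r * (chebyshevT R m).[c]).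
Proof.
elim: m => [|m IH].
  rewrite /ln_series big_ord0 deriv0 chebyshevT0 chebyshevT1 !hornerE; ring.
rewrite /ln_series big_ord_recr /= -/(ln_series c m) derivD hornerD mulrDr IH.
rewrite derivZ derivXn /= hornerZ hornerMn hornerXn chebyshevT_hornerSS.
rewrite -[r ^+ m *+ _]mulr_natr !(exprS _ m).
have m1 : m.+1%:R != 0 :> R by rewrite pnatr_eq0.
by field.
Qed.

(** On [[0, 1]] the remainder of the differentiated series is O(r^m), so it is
    compared with the derivative of r^(m+1) by the mean value theorem of
    Cauchy. The constant comes from the identity
    2 (1 + 2 c r + r^2) = (1 + r)^2 (1 + c) + (1 - r)^2 (1 - c) >= 1 + c. *)
Lemma ln_chebyshev_series {R : realType} (c : R) (m : nat) :
  -1 < c -> c <= 1 ->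
  `|ln (2 * (1 + c)) / 2 - (ln_series c m).[1]| <=
    4 / ((1 + c) * m.+1%:R).
Proof.
move=> c_gtN1 c_le1.
have hc : -1 <= c <= 1 by rewrite ltW.
pose q : {poly R} := 1 + (2 * c) *: 'X + 'X^2.
have qE r : q.[r] = 1 + 2 * c * r + r ^+ 2 by rewrite /q !hornerE.
have q_ge (r : R) : 0 <= r -> (1 + c) / 2 <= q.[r].
  move=> r0; rewrite qE -subr_ge0.
  have -> : 1 + 2 * c * r + r ^+ 2 - (1 + c) / 2 =
    ((2 * r + r ^+ 2) * (1 + c) + (1 - r) ^+ 2 * (1 - c)) / 2 by field.
  apply: divr_ge0 => //; apply: addr_ge0; apply: mulr_ge0; rewrite ?sqr_ge0//; nra.
have q_gt0 (r : R) : 0 <= r -> 0 < q.[r].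
  by move=> r0; apply: lt_le_trans (q_ge r r0); lra.
pose P := ln_series c m.
pose f (r : R) := ln q.[r] / 2 - P.[r].
pose df (r : R) := q^`().[r] / q.[r] / 2 - P^`().[r].
have f_der (r : R) : 0 <= r -> is_derive r (1 : R) f (df r).
  move=> r0; apply: is_deriveB.
  have dln : is_derive r (1 : R) (@ln R \o horner q) (q.[r]^-1 * q^`().[r]).
    by apply: is_derive1_comp; apply: is_derive1_ln; exact: q_gt0.
  rewrite (_ : (fun r => ln q.[r] / 2) = 2^-1 \*: (@ln R \o horner q)); last first.
    by apply/funext => y /=; rewrite /GRing.scale/= mulrC.
  rewrite (_ : _ / 2 = 2^-1 *: (q.[r]^-1 * q^`().[r])); last first.
    by rewrite /GRing.scale/= mulrC; congr (_ * _); rewrite mulrC.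
  exact: is_deriveZ.
have derc (g dg : R -> R) : (forall r : R, 0 <= r -> is_derive r (1 : R) g (dg r)) ->
    {within `[0, 1], continuous g}.
  move=> hg; apply: derivable_within_continuous => r.
  rewrite in_itv/= => /andP[r0 _]; by case: (hg r r0).
pose g (r : R) : R := ('X^(m.+1)).[r].
pose dg (r : R) : R := (('X^(m.+1) : {poly R})^`()).[r].
have dgE r : dg r = m.+1%:R * r ^+ m.
  by rewrite /dg derivXn hornerMn hornerXn mulr_natl.
have g_der (r : R) : 0 <= r -> is_derive r (1 : R) g (dg r).
  by move=> _; exact: is_derive_poly.
have in01 (r : R) : r \in `]0, 1[ -> 0 < r by rewrite in_itv/= => /andP[].
have [r] := @cauchy_MVT R f df g dg 0 1 ltr01 (derc _ _ f_der) (derc _ _ g_der)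
  (fun r h => f_der r (ltW (in01 r h))) (fun r h => g_der r (ltW (in01 r h)))
  (fun r h => ltac:(by rewrite dgE mulf_neq0// ?pnatr_eq0// expf_neq0// gt_eqF// in01)).
rewrite in_itv/= => /andP[r0 r1].
have f0 : f 0 = 0.
  rewrite /f qE /P /ln_series horner_sum big1 => [|k _]; last first.
    by rewrite !hornerE expr0n mulr0.
  by rewrite mulr0 expr0n !addr0 ln1 mul0r subr0.
have f1 : f 1 = ln (2 * (1 + c)) / 2 - P.[1].
  by rewrite /f qE; congr (ln _ / 2 - _); ring.
have -> : g 1 - g 0 = 1 by rewrite /g !hornerXn expr1n expr0n subr0.
rewrite f0 f1 divr1 subr0 => <-.
have qr0 := q_gt0 r (ltW r0).
have rm0 : r ^+ m != 0 by rewrite expf_neq0// gt_eqF.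
have m10 : m.+1%:R != 0 :> R by rewrite pnatr_eq0.
have -> : df r / dg r = (-1) ^+ m *
    ((chebyshevT R m.+1).[c] + r * (chebyshevT R m).[c]) / (q.[r] * m.+1%:R).
  have dq : q^`().[r] = 2 * (c + r).
    rewrite /q !derivD -polyC1 derivC derivZ derivX derivXn add0r alg_polyC.
    by rewrite mulr2n !hornerD hornerC !hornerX; ring.
  have /(canRL (mulKf (lt0r_neq0 qr0))) -> :
      q.[r] * df r = (-1) ^+ m * r ^+ m *
        ((chebyshevT R m.+1).[c] + r * (chebyshevT R m).[c]).
    rewrite /df mulrBr [X in _ - X](_ : _ = c + r - (-1) ^+ m * r ^+ m *
      ((chebyshevT R m.+1).[c] + r * (chebyshevT R m).[c])); last first.
      by rewrite qE ln_series_deriv.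
    by rewrite dq; field; rewrite gt_eqF.
  by rewrite dgE; field; rewrite nat1r m10 rm0 gt_eqF.
rewrite normrM normrM normrX normrN1 expr1n mul1r normfV.
rewrite [`|q.[r] * _|]gtr0_norm ?mulr_gt0 ?ltr0n//.
have num_le : `|(chebyshevT R m.+1).[c] + r * (chebyshevT R m).[c]| <= 2.
  apply: le_trans (ler_normD _ _) _; rewrite (_ : 2 = 1 + 1)//.
  apply: lerD; first exact: chebyshevT_norm_le1.
  by rewrite normrM gtr0_norm// mulr_ile1 ?chebyshevT_norm_le1 ?(ltW r0) ?(ltW r1).
apply: le_trans (ler_wpM2r _ num_le) _; first by rewrite invr_ge0 mulr_ge0// ltW.
have c0 : 0 < 1 + c by lra.
rewrite (_ : 4 / _ = 2 * ((1 + c) / 2 * m.+1%:R)^-1); last first.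
  by field; rewrite ?nat1r ?m10 gt_eqF.
rewrite ler_pM2l// lef_pV2 ?posrE ?mulr_gt0 ?ltr0n// ?invr_gt0//.
by rewrite ler_pM2r ?ltr0n// q_ge// ltW.
Qed.

(** * The partial sums p_m *)

Lemma rescale_itv {R : realType} (x0 x : R) :
  0 < x0 -> 0 <= x <= x0 -> -1 <= 2 / x0 * x - 1 <= 1.
Proof.
move=> x0_gt0 /andP[x_ge0 x_le].
rewrite mulrAC lerBrDr addNr lerBlDr ler_pdivrMr// divr_ge0 ?mulr_ge0 ?(ltW x0_gt0)//=.
by lra.
Qed.

Lemma chebyshevT_trans_horner {R : realType} (x0 x : R) (k : nat) :
  (chebyshevT_trans x0 k).[x] = (chebyshevT R k).[2 / x0 * x - 1].
Proof. by rewrite /chebyshevT_trans horner_comp !hornerE. Qed.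

Lemma xlogx_approxS {R : realType} (x0 x : R) (n : nat) :
  (xlogx_approx x0 n.+1).[x] = (xlogx_approx x0 n).[x] +
    xlogx_coef x0 n.+1 * (chebyshevT R n.+1).[2 / x0 * x - 1].
Proof.
rewrite /xlogx_approx big_nat_recr//= addrA [LHS]hornerD hornerZ.
by rewrite chebyshevT_trans_horner.
Qed.

Lemma xlogx_coefSS {R : realType} (x0 : R) (k : nat) :
  xlogx_coef x0 k.+2 = (-1) ^+ k * x0 / (k.+1%:R * k.+2%:R * k.+3%:R).
Proof.
rewrite /xlogx_coef !exprS mulrA mulN1r opprK mul1r; congr (_ / _).
by rewrite -!natr1; ring.
Qed.

(** Multiplication by 1 + c acts on the coefficients as a second difference;
    the terms T_(m+1) and T_(m+2) are those for which one of the three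
    contributions falls outside of the partial sum. *)
Lemma xlogx_approx_ln_series {R : realType} (x0 x : R) (m : nat) :
  x0 != 0 -> let c := 2 / x0 * x - 1 in
  (xlogx_approx x0 m.+1).[x] =
  x * ln (x0 / 4) + 2 * x * (ln_series c m.+1).[1] -
  (-1) ^+ m * x0 * ((chebyshevT R m.+1).[c] / (2 * m.+2%:R) +
                    (chebyshevT R m.+2).[c] / (2 * m.+1%:R)).
Proof.
move=> x0_neq0 c.
elim: m => [|m IH].
  rewrite xlogx_approxS /xlogx_approx big_geq// addr0 hornerC /ln_series.
  rewrite big_ord_recr big_ord0 /= add0r chebyshevT_hornerSS chebyshevT0.
  rewrite chebyshevT1 hornerZ hornerXn expr1n !hornerX -polyC1 hornerC expr0 /c; field.
  by rewrite x0_neq0.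
rewrite xlogx_approxS IH xlogx_coefSS -/c.
rewrite [in RHS]/ln_series big_ord_recr/= -/(ln_series c m.+1) hornerD hornerZ.
rewrite hornerXn expr1n (chebyshevT_hornerSS m.+1) exprS.
have xE : x = x0 * (1 + c) / 2 by rewrite /c; field.
rewrite [in RHS]xE [in LHS]xE -!natr1.
have m0 : 0 <= m%:R :> R by [].
by field; rewrite !lt0r_neq0//; lra.
Qed.

(** The triangle inequality with |T_k| <= 1 leaves a telescoping sum:
    1 / (k (k^2 - 1)) = 1 / (2 (k - 1) k) - 1 / (2 k (k + 1)). *)
Lemma xlogx_approx_tail {R : realType} (x0 x : R) (n d : nat) :
  0 < x0 -> 0 <= x <= x0 ->
  `|(xlogx_approx x0 (n.+1 + d)).[x] - (xlogx_approx x0 n.+1).[x]| <=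
  x0 / (2 * n.+1%:R * n.+2%:R) -
  x0 / (2 * (n.+1 + d)%:R * (n.+1 + d).+1%:R).
Proof.
move=> x0_gt0 hx; have hc := rescale_itv x0 x x0_gt0 hx.
elim: d => [|d IH]; first by rewrite addn0 !subrr normr0.
rewrite addnS xlogx_approxS addrAC; apply: le_trans (ler_normD _ _) _.
move: IH; rewrite addSn; set N := (n + d)%N => IH.
have a_le : `|xlogx_coef x0 N.+2 * (chebyshevT R N.+2).[2 / x0 * x - 1]| <=
    x0 / (N.+1%:R * N.+2%:R * N.+3%:R).
  rewrite xlogx_coefSS normrM.
  apply: le_trans (ler_piMr (normr_ge0 _) (chebyshevT_norm_le1 _ _ hc)) _.
  by rewrite normrM normrM normrX normrN1 expr1n mul1r normfV !gtr0_norm//.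
apply: le_trans (lerD IH a_le) _; rewrite le_eqVlt; apply/orP; left; apply/eqP.
rewrite -!natr1.
have N0 : 0 <= N%:R :> R by [].
have n0 : 0 <= n%:R :> R by [].
by field; rewrite !lt0r_neq0//; lra.
Qed.

(** Of the constant 5, the remainder of the logarithmic series accounts for 4,
    the factor x = x0 (1 + c) / 2 cancelling the singularity at c = -1, and the
    two boundary terms account for 1. Only the decay in m is used below. *)
Lemma xlogx_approx_rate {R : realType} (x0 x : R) (m : nat) :
  0 < x0 -> 0 <= x <= x0 ->
  `|xlogx x - (xlogx_approx x0 m.+1).[x]| <= 5 * x0 / m.+1%:R.
Proof.
move=> x0_gt0 hx; have hc := rescale_itv x0 x x0_gt0 hx.
case/andP: hx => x_ge0 x_le.
rewrite xlogx_approx_ln_series ?gt_eqF//=; set c := 2 / x0 * x - 1 in hc *.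
have m1 : 0 < m.+1%:R :> R by rewrite ltr0n.
have boundary : `|(-1) ^+ m * x0 * ((chebyshevT R m.+1).[c] / (2 * m.+2%:R) +
    (chebyshevT R m.+2).[c] / (2 * m.+1%:R))| <= x0 / m.+1%:R.
  rewrite normrM normrM normrX normrN1 expr1n mul1r gtr0_norm//.
  rewrite ler_pM2l//; apply: le_trans (ler_normD _ _) _.
  have half (k : nat) (y : R) : `|y| <= 1 -> (m < k)%N ->
      `|y / (2 * k%:R)| <= m.+1%:R^-1 / 2.
    move=> y1 mk; have k0 : 0 < k%:R :> R by rewrite ltr0n (leq_trans _ mk).
    rewrite normrM normfV [`|2 * _|]gtr0_norm ?mulr_gt0//.
    rewrite -[leRHS]mul1r -invfM; apply: ler_pM => //.
    by rewrite lef_pV2 ?posrE ?mulr_gt0// [_ * 2]mulrC ler_pM2l// ler_nat.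
  by rewrite [leRHS]splitr; apply: lerD; apply: half => //;
    exact: chebyshevT_norm_le1.
have main : `|xlogx x - x * ln (x0 / 4) - 2 * x * (ln_series c m.+1).[1]| <=
    4 * x0 / m.+1%:R.
  rewrite /xlogx; case: ifPn => [x_gt0|]; last first.
    rewrite -leNgt => xle0; have -> : x = 0 by apply/le_anti; rewrite xle0.
    by rewrite !mulr0 !mul0r !subr0 normr0 divr_ge0// mulr_ge0// ltW.
  have c1 : 0 < 1 + c by rewrite /c addrC subrK mulr_gt0// divr_gt0.
  have cE : 2 * (1 + c) = x / (x0 / 4) by rewrite /c; field; rewrite gt_eqF.
  have := ln_chebyshev_series c m.+1 ltac:(lra) ltac:(by case/andP: hc).
  rewrite cE ln_div ?posrE ?divr_gt0// => err.
  have -> : x * ln x - x * ln (x0 / 4) - 2 * x * (ln_series c m.+1).[1] =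
    2 * x * ((ln x - ln (x0 / 4)) / 2 - (ln_series c m.+1).[1]) by field.
  rewrite normrM gtr0_norm ?mulr_gt0//.
  apply: le_trans (ler_wpM2l _ err) _; first by rewrite mulr_ge0// ltW.
  have -> : 2 * x * (4 / ((1 + c) * m.+2%:R)) = 4 * x0 / m.+2%:R.
    by rewrite /c -natr1; field; rewrite !lt0r_neq0//; lra.
  by rewrite ler_pM2l ?mulr_gt0// lef_pV2 ?posrE ?ltr0n// ler_nat.
set B := (-1) ^+ m * _ * _ in boundary *.
rewrite (_ : _ - _ = xlogx x - x * ln (x0 / 4) -
  2 * x * (ln_series c m.+1).[1] + B); last by ring.
apply: le_trans (ler_normD _ _) _.
rewrite (_ : 5 * x0 / _ = 4 * x0 / m.+1%:R + x0 / m.+1%:R); last first.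
  by field; rewrite gt_eqF.
exact: lerD.
Qed.

Theorem proposition3p1 (R : realType) (x0 : R) (n : nat)
    (hx0 : 0 < x0) (hn : (1 <= n)%N) :
  (sup_norm 0 x0 (fun x : R => (xlogx x - (xlogx_approx x0 n).[x])%R)
     <= (x0 / (2 * n%:R * (n%:R + 1)))%:E)%E.
Proof.
case: n hn => // n _; rewrite natr1.
apply/ereal_supP => _ /= [x + <-]; rewrite in_itv/= lee_fin => hx.
apply/ler_addgt0Pr => e e0.
(* Past this index the convergence rate 5 * x0 / m is below e. *)
pose d := Num.truncn (5 * x0 / e).
rewrite -(subrKA (xlogx_approx x0 (n.+1 + d)).[x]).
apply: le_trans (ler_normD _ _) _; rewrite addrC; apply: lerD.
  apply: le_trans (xlogx_approx_tail x0 x n d hx0 hx) _.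
  by rewrite gerBl divr_ge0 ?mulr_ge0// ltW.
rewrite addSn; apply: le_trans (xlogx_approx_rate x0 x (n + d) hx0 hx) _.
rewrite ler_pdivrMr ?ltr0n// [leRHS]mulrC -ler_pdivrMr//.
apply: le_trans (ltW (truncnS_gt _)) _.
by rewrite ler_nat ltnS leq_addl.
Qed.
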